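(* Let $I \subset \mathbb{R}$ be an interval with interior $I^{\circ}$, let $f : I \to \mathbb{R}_+$ be a differentiable function on $I^{\circ}$, and let $a,b \in I$ with $a<b$ and $f' \in L[a,b]$. If $|f'|^q$ is geometrically convex and monotonically decreasing on $[a,b]$ for $q\ge 1$, then for $x\in[a,b]$ the following inequality holds: $$\left| \frac{(b-x)f(b)+(x-a)f(a)}{b-a}-\frac{1}{b-a}\int_a^b f(u)\,du\right| \le \left(\frac12\right)^{1-\frac1q}\left\{ \frac{(x-a)^2}{b-a}\,|f'(a)|\left(\frac{k-\log k-1}{(\log k)^2}\right)^{\frac1q} + \frac{(b-x)^2}{b-a}\,|f'(b)|\left(\frac{l-\log l-1}{(\log l)^2}\right)^{\frac1q}\right\},$$ where $$k=\frac{|f'(x)|^q}{|f'(a)|^q}\quad\text{and}\quad l=\frac{|f'(x)|^q}{|f'(b)|^q}.$$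
   Context: $\mathbb{R}_+$ denotes the positive reals, $L[a,b]$ the integrable functions on $[a,b]$, and $\log$ the natural logarithm. A function $g : J\subset\mathbb{R}_+ \to \mathbb{R}_+$ is geometrically convex if $g(y^{t}z^{1-t}) \le [g(y)]^{t}[g(z)]^{1-t}$ for all $y,z\in J$ and $t\in[0,1]$.
   Formalization: Where k=1 or l=1 (always at x=a, resp. x=b) the quotient (k-log k-1)/(log k)^2 is 0/0; it is read as its limit 1/2. f is also assumed differentiable (one-sidedly if an endpoint of I) at a and b, so that f'(a) and f'(b) exist. *)

(* Defs.v *)
From HB Require Import structures.
From mathcomp Require Import all_boot all_order all_algebra.
From mathcomp Require Import all_classical all_reals all_analysis.

Set Implicit Arguments.
Unset Strict Implicit.
Unset Printing Implicit Defensive.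

Import Order.TTheory GRing.Theory Num.Theory.
Import numFieldNormedType.Exports.

Local Open Scope classical_set_scope.
Local Open Scope ring_scope.

Section Definitions.
Context {R : realType}.
Implicit Types (A J : set R) (f g : R -> R).

(* Derivative of f at y computed only from the values of f on A. It is the
   one-sided derivative at an endpoint of an interval A and the usual one at an
   interior point (derivable_within_interior, derive_within_interior), so the
   values outside A of the total function f play no role. *)
Definition derivable_within A f (y : R) : Prop :=
  cvg ((fun h : R => h^-1 * (f (h + y) - f y))
         @ within [set h : R | A (h + y)] 0^').

Definition derive_within A f (y : R) : R :=
  lim ((fun h : R => h^-1 * (f (h + y) - f y))
         @ within [set h : R | A (h + y)] 0^').

Lemma within_interior_dnbhs A (y : R) :
  A° y -> within [set h : R | A (h + y)] 0^' = 0^'.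
Proof.
move=> Ay.
have Ah : \forall h \near (0 : R)^', A (h + y).
  apply: cvg_within.
  have : h + y @[h --> (0 : R)] --> y.
    rewrite -[X in _ --> X]add0r.
    by apply: cvgD; [exact: cvg_id | exact: cvg_cst].
  exact.
apply/seteqP; split => P /= HP.
- rewrite /within /= in HP; near=> h; near: h.
  by apply: filterS2 Ah HP => h hA; apply.
- by rewrite /within /=; apply: filterS HP => h Ph _.
Unshelve. all: by end_near. Qed.

Lemma derivable_within_interior A f (y : R) :
  A° y -> derivable_within A f y <-> derivable f y 1.
Proof.
move=> /within_interior_dnbhs Ay; rewrite /derivable_within Ay /derivable.
suff -> : (fun h : R => h^-1 *: ((f \o shift y) (h *: 1) - f y)) =
          (fun h : R => h^-1 * (f (h + y) - f y)) by [].
by apply/funext => h /=; rewrite scaler1.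
Qed.

Lemma derive_within_interior A f (y : R) :
  A° y -> derive_within A f y = derive1 f y.
Proof.
move=> /within_interior_dnbhs Ay; rewrite /derive_within Ay /derive1.
by [].
Qed.

(* The positivity clauses encode that g maps J into the positive reals and that
   J consists of positive reals. *)
Definition geometrically_convex J g : Prop :=
  [/\ (forall y, J y -> 0 < y),
      (forall y, J y -> 0 < g y) &
      (forall y z t, J y -> J z -> 0 <= t <= 1 ->
         g (y `^ t * z `^ (1 - t)) <= g y `^ t * g z `^ (1 - t))].

(* (c - log c - 1) / (log c)^2 has a removable singularity at c = 1 with limit
   1/2, whereas division by zero in R would silently give the value 0. *)
Definition log_coef (c : R) : R :=
  if c == 1 then 2^-1 else (c - ln c - 1) / (ln c) ^+ 2.

End Definitions.

(* Main.v *)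
(* Let G be an antiderivative of f. The quantity to bound is 1/(b - a) times the
   difference of the first-order Taylor remainders of G between a and x and
   between b and x. On the segment from p (p = a or b) to x, weighted AM-GM,
   monotonicity and geometric convexity give, with c = |f' x|^q / |f' p|^q,
     |f'(t x + (1 - t) p)|^q <= |f'(x^t p^(1-t))|^q <= |f' p|^q c^t,
   and the Taylor remainder is dominated by the double primitive of the bound on
   the second derivative f' of G; the double primitive of c^t vanishing to first
   order at 0 takes the value (c - log c - 1) / (log c)^2 at 1. *)
Require Import Defs.
From HB Require Import structures.
From mathcomp Require Import all_boot all_order all_algebra.
From mathcomp Require Import all_classical all_reals all_analysis.
From mathcomp Require Import ring lra.

Import Order.TTheory GRing.Theory Num.Theory.
Import numFieldNormedType.Exports.

Local Open Scope classical_set_scope.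
Local Open Scope ring_scope.

(** * Weighted AM-GM and domination of Taylor remainders *)

(** Concavity of [ln] at the weights [t] and [1 - t], read back through monotonicity of [ln]. It
    serves both to compare points of a segment with geometric means and to stand in for the power
    mean inequality. *)
Lemma powR_weighted_AMGM (R : realType) (y z t : R) :
  0 < y -> 0 < z -> 0 <= t <= 1 ->
  y `^ t * z `^ (1 - t) <= t * y + (1 - t) * z.
Proof.
move=> y0 z0 /andP[t0 t1].
have := @concave_ln R (Itv01 t0 t1) y z y0 z0.
have h : 0 < t * y + (1 - t) * z.
  have [->|tn1] := eqVneq t 1; first by rewrite mul1r subrr mul0r addr0.
  apply: ltr_wpDl; first by rewrite mulr_ge0// ltW.
  by rewrite mulr_gt0// subr_gt0 lt_neqAle tn1.
rewrite !convRE /= /unstable.onem => H.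
rewrite -ler_ln ?posrE ?mulr_gt0 ?powR_gt0//.
by rewrite lnM ?posrE ?powR_gt0// !ln_powR.
Qed.

(** The mean value theorem, applied to [g + psi] and [psi - g], whose derivatives are nonnegative,
    turns a pointwise bound on [dg] into a bound on increments. *)
Lemma is_derive_dominated (R : realType) (g dg psi dpsi : R -> R) (a b : R) :
  a <= b ->
  {within `[a, b], continuous g} ->
  (forall t : R, t \in `]a, b[ -> is_derive t 1 g (dg t)) ->
  (forall t : R, is_derive t 1 psi (dpsi t)) ->
  (forall t : R, t \in `]a, b[ -> `|dg t| <= dpsi t) ->
  `|g b - g a| <= psi b - psi a.
Proof.
rewrite le_eqVlt => /predU1P[<-|ab] gc gd psid dle.
  by rewrite !subrr normr0.
have pc : {within `[a, b], continuous psi}.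
  apply: continuous_subspaceT => t.
  by apply/differentiable_continuous/derivable1_diffP; case: (psid t).
rewrite ler_norml; apply/andP; split.
- have [||c cab] := @MVT R (g + psi) (fun t => dg t + dpsi t) a b ab.
  + by move=> t tab; have := gd t tab; have := psid t => *; exact: is_deriveD.
  + by move=> t; apply: continuousD; [exact: gc|exact: pc].
  have := dle c cab; rewrite ler_norml => /andP[h _] e.
  have : 0 <= (g + psi) b - (g + psi) a.
    by rewrite e mulr_ge0 ?subr_ge0 ?(ltW ab)//; lra.
  by rewrite /= !fctE; lra.
- have [||c cab] := @MVT R (psi - g) (fun t => dpsi t - dg t) a b ab.
  + by move=> t tab; have := gd t tab; have := psid t => *; exact: is_deriveB.
  + by move=> t; apply: continuousD; [exact: pc|apply: continuousN; exact: gc].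
  have := dle c cab; rewrite ler_norml => /andP[_ h] e.
  have : 0 <= (psi - g) b - (psi - g) a.
    by rewrite e mulr_ge0 ?subr_ge0 ?(ltW ab)//; lra.
  by rewrite /= !fctE; lra.
Qed.

(** Domination is used twice: for [h] against [Psi1] on [[0, t]], then on [[0, 1]] for [g] against
    [Psi0] after subtracting the linear parts of slopes [h 0] and [Psi1 0]. *)
Lemma taylor1_dominated (R : realType) (g h dh Psi0 Psi1 Psi2 : R -> R) :
  {within `[0, 1], continuous g} -> {within `[0, 1], continuous h} ->
  (forall t : R, t \in `]0, 1[ -> is_derive t 1 g (h t)) ->
  (forall t : R, t \in `]0, 1[ -> is_derive t 1 h (dh t)) ->
  (forall t : R, is_derive t 1 Psi0 (Psi1 t)) ->
  (forall t : R, is_derive t 1 Psi1 (Psi2 t)) ->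
  (forall t : R, t \in `]0, 1[ -> `|dh t| <= Psi2 t) ->
  `|g 1 - g 0 - h 0| <= Psi0 1 - Psi0 0 - Psi1 0.
Proof.
move=> gc hc gd hd P0d P1d dhle.
have hle t : t \in `]0, 1[ -> `|h t - h 0| <= Psi1 t - Psi1 0.
  rewrite in_itv /= => /andP[t0 t1].
  have sub (s : R) : s \in `]0, t[ -> s \in `]0, 1[.
    rewrite !in_itv /= => /andP[s0 st].
    by rewrite s0 (lt_trans st).
  have hct : {within `[0, t], continuous h}.
    apply: continuous_subspaceW hc.
    by apply: subset_itvl; rewrite bnd_simp ltW.
  exact: (@is_derive_dominated R h dh Psi1 Psi2 0 t (ltW t0) hct
    (fun s ts => hd s (sub s ts)) P1d (fun s ts => dhle s (sub s ts))).
have gc' : {within `[0, 1], continuous (g - ( *%R (h 0)))}.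
  move=> t; apply: continuousD; first exact: gc.
  apply: continuousN; move: t.
  apply: continuous_subspaceT => s; exact: mulrl_continuous.
have := @is_derive_dominated R (g - ( *%R (h 0))) (fun t => h t - h 0)
  (Psi0 - ( *%R (Psi1 0))) (fun t => Psi1 t - Psi1 0) 0 1 ler01 gc'.
rewrite /= !fctE !mulr0 !mulr1 !subr0 => H.
have <- : g 1 - h 0 - g 0 = g 1 - g 0 - h 0 by ring.
have -> : Psi0 1 - Psi0 0 - Psi1 0 = Psi0 1 - Psi1 0 - Psi0 0 by ring.
have lin (c t : R) : is_derive t 1 ( *%R c) c.
  have -> : ( *%R c) = (c *: (@id R)) by apply/funext => s.
  apply: is_derive_eq; exact: mulr1.
apply: H => //.
by move=> t tab; have := gd t tab; have := lin (h 0) t => *; exact: is_deriveB.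
Qed.

(** * The constant [log_coef] and the double primitive of [k^t] *)

Lemma log_coef_gt0 (R : realType) (k : R) : 0 < k -> 0 < log_coef k.
Proof.
move=> k0; rewrite /log_coef; case: eqVneq => [//|k1].
have lk : ln k != 0.
  by apply: contra_neq k1 => lk0; rewrite -[k]lnK ?posrE// lk0 expR0.
rewrite divr_gt0 ?exprn_even_gt0//.
(* The strict inequality [1 + s < expR s] at [s = ln k] makes the numerator positive. *)
by have := expR_gt1Dx lk; rewrite lnK ?posrE//; lra.
Qed.

Lemma is_derive_half_sqr (R : realType) (t : R) :
  is_derive t 1 (fun s : R => 2^-1 * s ^+ 2) t.
Proof.
have -> : (fun s : R => 2^-1 * s ^+ 2) = 2^-1 *: (fun s : R => s ^+ 2) by [].
by apply: is_derive_eq; rewrite /= /GRing.scale /= ?expr1; field.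
Qed.

(** For [k != 1], dividing [k^t] by [ln k] once and twice gives the primitives. At [k = 1]
    polynomial primitives take over and produce the special value 1/2 of [log_coef]. *)
Lemma powR_double_primitive (R : realType) (k : R) : 0 < k ->
  exists P0 P1 : R -> R,
  [/\ forall t : R, is_derive t 1 P0 (P1 t),
      forall t : R, is_derive t 1 P1 (k `^ t) &
      P0 1 - P0 0 - P1 0 = log_coef k].
Proof.
move=> k0; have [->|k1] := eqVneq k 1.
  exists (fun t => 2^-1 * t ^+ 2), id; split => [t|t|].
  - exact: is_derive_half_sqr.
  - by rewrite powR1; exact: is_derive_id.
  - by rewrite /log_coef eqxx; field.
have lk : ln k != 0.
  by apply: contra_neq k1 => lk0; rewrite -[k]lnK ?posrE// lk0 expR0.
have kE t : k `^ t = expR (ln k * t) by rewrite /powR gt_eqF// mulrC.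
have Ed (t : R) :
    is_derive t 1 (fun s => expR (ln k * s)) (ln k * expR (ln k * t)).
  have -> : (fun s => expR (ln k * s)) = expR \o (ln k *: (@id R)) by [].
  by apply: is_derive_eq; rewrite /= /GRing.scale /=; ring.
exists (fun t => (ln k) ^-2 * expR (ln k * t)),
  (fun t => (ln k)^-1 * expR (ln k * t)).
split => [t|t|].
- have -> : (fun s => (ln k) ^-2 * expR (ln k * s)) =
     (ln k) ^-2 *: (fun s => expR (ln k * s)) by [].
  by apply: is_derive_eq; rewrite /= /GRing.scale /=; field.
- have -> : (fun s => (ln k)^-1 * expR (ln k * s)) =
     (ln k)^-1 *: (fun s => expR (ln k * s)) by [].
  by apply: is_derive_eq; rewrite /= /GRing.scale /= kE; field.
rewrite mulr1 mulr0 expR0 lnK ?posrE// /log_coef (negbTE k1); field.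
exact: lk.
Qed.

(** The constant is the power mean bound for the integral of [(1 - t) k^(t/q)] over [[0, 1]]: the
    weight [1 - t] has mass 1/2, and [(1 - t) k^t] has integral [log_coef k]. *)
Lemma taylor1_powR (R : realType) (g h dh : R -> R) (D k q : R) :
  1 <= q -> 0 <= D -> 0 < k ->
  {within `[0, 1], continuous g} -> {within `[0, 1], continuous h} ->
  (forall t : R, t \in `]0, 1[ -> is_derive t 1 g (h t)) ->
  (forall t : R, t \in `]0, 1[ -> is_derive t 1 h (dh t)) ->
  (forall t : R, t \in `]0, 1[ -> `|dh t| <= D * (k `^ t) `^ q^-1) ->
  `|g 1 - g 0 - h 0| <= D * ((1 / 2) `^ (1 - 1 / q) * log_coef k `^ (1 / q)).
Proof.
move=> q1 D0 k0 gc hc gd hd dhle.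
have q0 : 0 < q by lra.
have qn0 : q != 0 by lra.
have L0 := @log_coef_gt0 R k k0; set L := log_coef k in L0 *.
(* By weighted AM-GM, [k^(t/q) <= m^(1-q) k^t / q + (1 - 1/q) m] for every
   [m > 0]; this [m] minimises the double integral of the right-hand side and
   replaces the power mean inequality. *)
pose m := (2 * L) `^ q^-1.
have m0 : 0 < m by rewrite powR_gt0// mulr_gt0.
have [P0 [P1 [P0d P1d PE]]] := @powR_double_primitive R k k0.
pose al := D * (q^-1 * m `^ (1 - q)); pose be := D * ((1 - q^-1) * m).
have sqd := @is_derive_half_sqr R.
have := @taylor1_dominated R g h dh (al *: P0 + be *: (fun s => 2^-1 * s ^+ 2))
  (al *: P1 + be *: id) (fun t => al * k `^ t + be) gc hc gd hd.
(* Since [m^q = 2 L], the term [al * L] is [D m / (2 q)]; adding [be / 2] gives [D m / 2], the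
   target constant. *)
have -> : D * ((1 / 2) `^ (1 - 1 / q) * L `^ (1 / q)) = al * L + be * 2^-1.
  have mq : m `^ q = 2 * L by rewrite -powRrM mulVf// powRr1// mulr_ge0// ltW.
  have -> : al * L = D * (q^-1 * m * 2^-1).
    have -> : L = m `^ q * 2^-1 by rewrite mq; field.
    rewrite /al -mulrA -[q^-1 * _ * _]mulrA; congr (D * _).
    rewrite mulrA -[q^-1 * _ * _]mulrA -powRD ?subrK ?powRr1 ?(ltW m0)//.
      by rewrite mulrA.
    by rewrite (gt_eqF m0) implybT.
  have -> : (1 / 2) `^ (1 - 1 / q) * L `^ (1 / q) = m * 2^-1.
    rewrite /m powRM ?(ltW L0)// !div1r.
    have -> : 2 `^ q^-1 = (2^-1 : R) `^ (- q^-1).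
      by rewrite -[2^-1]powR_inv1// -powRrM mulN1r opprK.
    rewrite powRD; last by rewrite invr_eq0 pnatr_eq0 implybT.
    by rewrite powRr1 ?invr_ge0//; ring.
  by rewrite /be; field.
rewrite !fctE /= => H; apply: le_trans (H _ _ _) _.
- move=> t; have := P1d t => *.
  by apply: is_derive_eq; rewrite /GRing.scale /= mulr1.
- move=> t tab; apply: le_trans (dhle t tab) _.
  rewrite /al /be -mulrA -mulrDr ler_wpM2l//.
  have iq : 0 <= q^-1 <= 1 by rewrite invr_ge0 ltW//= invf_le1.
  have y0 : 0 < m `^ (1 - q) * k `^ t by rewrite mulr_gt0// powR_gt0.
  rewrite -[q^-1 * _ * _]mulrA.
  (* AM-GM with weight [q^-1] between [m^(1-q) k^t] and [m]: the powers of [m] cancel in the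
     geometric mean, leaving [k^(t/q)]. *)
  apply: le_trans (powR_weighted_AMGM _ _ _ _ y0 m0 iq).
  rewrite powRM ?powR_ge0// mulrAC -[(m `^ _) `^ _]powRrM -powRD; last first.
    by rewrite (gt_eqF m0) implybT.
  have -> : (1 - q) / q + (1 - q^-1) = 0 by field.
  by rewrite powRr0 mul1r.
- by rewrite /GRing.scale /= /L -PE; lra.
Qed.

(** * Continuity, antiderivatives and Taylor bounds on a segment *)

(** Multiplying the convergent difference quotient by [h] gives increments tending to 0; the centre
    [h = 0], absent from the punctured filter, is restored by hand. *)
Lemma derivable_within_cvg (R : realType) (A : set R) (f : R -> R) (u : R) :
  derivable_within A f u -> f z @[z --> within A (nbhs u)] --> f u.
Proof.
move=> /cvg_ex[l sl].
have h0 : h @[h --> within [set h : R | A (h + u)] 0^'] --> (0 : R).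
  by apply: cvg_within_filter; apply: cvg_within.
have : h * (h^-1 * (f (h + u) - f u))
    @[h --> within [set h : R | A (h + u)] 0^'] --> (0 : R).
  by have := cvgM h0 sl; rewrite mul0r; apply.
move=> /cvgrPdist_lt hs.
apply/cvgrPdist_lt => e e0; have := hs e e0.
rewrite !near_withinE => H.
suff : \forall z \near u, A z -> `|f u - f z| < e by [].
rewrite (near_shift 0) /= subr0; near=> h.
rewrite /= => Ah; have [->|hn0] := eqVneq h 0.
  by rewrite add0r subrr normr0.
have : h != 0 -> A (h + u) -> `|0 - h * (h^-1 * (f (h + u) - f u))| < e.
  by near: h.
move=> /(_ hn0 Ah).
by rewrite mulrA divff// mul1r sub0r opprB.
Unshelve. all: by end_near. Qed.

Lemma continuous_antiderivative (R : realType) (f : R -> R) (a b : R) :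
  a < b -> {within `[a, b], continuous f} ->
  exists G : R -> R,
  [/\ {within `[a, b], continuous G},
      forall t : R, t \in `]a, b[ -> is_derive t 1 G (f t) &
      \int[lebesgue_measure]_(u in `[a, b]) f u = G b - G a].
Proof.
move=> ab fc.
have fi := continuous_compact_integrable (@segment_compact R a b) fc.
exists (fun z => parameterized_integral lebesgue_measure a z f); split.
- exact: parameterized_integral_continuous (ltW ab) fi.
- move=> t tab; have := tab; rewrite in_itv /= => /andP[at_ tb].
  have [Fd <-] := continuous_FTC1_closed tb fi at_
    (within_continuous_continuous ab fc tab).
  by rewrite derive1E; exact: DeriveDef.
- by rewrite /parameterized_integral set_itv1 Rintegral_set1 subr0.
Qed.

(* The point [t * y + (1 - t) * p] runs from [p] to [y] in either orientation,
   so this covers both [p = a] and [p = b]. *)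
Lemma segment_taylor1 (R : realType) (f f' G : R -> R) (a b p y k q : R) :
  {within `[a, b], continuous f} -> {within `[a, b], continuous G} ->
  (forall t : R, t \in `]a, b[ -> is_derive t 1 f (f' t)) ->
  (forall t : R, t \in `]a, b[ -> is_derive t 1 G (f t)) ->
  p \in `[a, b] -> y \in `[a, b] -> 1 <= q -> 0 < k ->
  (forall t : R, t \in `]0, 1[ ->
     `|f' (t * y + (1 - t) * p)| <= `|f' p| * (k `^ t) `^ q^-1) ->
  `|G y - G p - (y - p) * f p| <=
  (y - p) ^+ 2 * `|f' p| * ((1 / 2) `^ (1 - 1 / q) * log_coef k `^ (1 / q)).
Proof.
move=> fc Gc fd Gd pab yab q1 k0 f'le.
(* A constant path would not send []0, 1[] into []a, b[] when [p] is an endpoint. *)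
have [->|py] := eqVneq y p.
  by rewrite !subrr expr0n/= !mul0r subr0 normr0.
pose ga t := t * y + (1 - t) * p.
have gaE : ga = (y - p) *: (@id R) + cst p.
  by apply/funext => t; rewrite /ga !fctE /= /GRing.scale /=; ring.
have gad (t : R) : is_derive t 1 ga (y - p).
  by rewrite gaE; apply: is_derive_eq; rewrite addr0; exact: mulr1.
have gacc t : t \in `[0, 1] -> ga t \in `[a, b].
  move: pab yab; rewrite !in_itv /= /ga => /andP[? ?] /andP[? ?] /andP[? ?].
  by apply/andP; split; nra.
have gaoo t : t \in `]0, 1[ -> ga t \in `]a, b[.
  move: pab yab; rewrite !in_itv /= /ga => /andP[? ?] /andP[? ?] /andP[? ?].
  by case: (ltgtP y p) py => // ? _; apply/andP; split; nra.
have comp (F : R -> R) : {within `[a, b], continuous F} ->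
    {within `[0, 1], continuous (F \o ga)}.
  move=> /subspace_continuousP Fc; apply/subspace_continuousP => t t01.
  have gat := gacc t t01.
  apply: cvg_comp (Fc _ gat) => U; rewrite /within /= !near_simpl => HU.
  have gat' : {for t, continuous ga}.
    by apply/differentiable_continuous/derivable1_diffP; case: (gad t).
  have := gat' _ HU; rewrite /= !near_simpl.
  by apply: filterS => s Hs s01; apply: Hs; exact: gacc.
have fgd (t : R) : t \in `]0, 1[ ->
    is_derive t 1 (f \o ga) (f' (ga t) * (y - p)).
  by move=> /gaoo /fd ?; apply: is_derive1_comp.
have ga1 : ga 1 = y by rewrite /ga; ring.
have ga0 : ga 0 = p by rewrite /ga; ring.
(* The left side is the Taylor remainder at 1 of [G \o ga]; its second derivative
   [(y - p)^2 f' (ga t)] accounts for the square. *)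
have -> : G y - G p - (y - p) * f p =
    (G \o ga) 1 - (G \o ga) 0 - ((y - p) *: (f \o ga)) 0.
  by rewrite !fctE /= ga1 ga0.
have D0 : 0 <= (y - p) ^+ 2 * `|f' p| by rewrite mulr_ge0// sqr_ge0.
have hc : {within `[0, 1], continuous ((y - p) *: (f \o ga))}.
  apply: (@within_continuous_comp _ _ _ _ (f \o ga) ( *%R (y - p)) _ (comp _ fc)).
  by move=> z _; exact: mulrl_continuous.
have gd (t : R) : t \in `]0, 1[ ->
    is_derive t 1 (G \o ga) (((y - p) *: (f \o ga)) t).
  move=> t01; have Gdt := Gd _ (gaoo t t01).
  have := @is_derive1_comp R G ga t _ _ Gdt (gad t).
  by rewrite mulrC.
have hd (t : R) : t \in `]0, 1[ ->
    is_derive t 1 ((y - p) *: (f \o ga)) ((y - p) ^+ 2 * f' (ga t)).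
  move=> /fgd fgdt.
  have := @is_deriveZ _ _ _ (f \o ga) (y - p) t 1 _ fgdt.
  by rewrite /GRing.scale /= mulrC -mulrA -expr2 mulrC.
have dhle (t : R) : t \in `]0, 1[ -> `|(y - p) ^+ 2 * f' (ga t)| <=
    (y - p) ^+ 2 * `|f' p| * (k `^ t) `^ q^-1.
  move=> t01; rewrite normrM normrX real_normK ?num_real// -mulrA.
  by rewrite ler_wpM2l ?sqr_ge0// f'le.
exact: (@taylor1_powR R _ _ _ _ _ _ q1 D0 k0 (comp _ Gc) hc gd hd dhle).
Qed.

(** * Geometric convexity along a segment *)

Lemma geometrically_convex_decreasing_le (R : realType) (g : R -> R)
    (a b p y t : R) :
  geometrically_convex `[a, b] g -> {in `[a, b] &, nonincreasing_fun g} ->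
  p \in `[a, b] -> y \in `[a, b] -> 0 <= t <= 1 ->
  g (t * y + (1 - t) * p) <= g p * (g y / g p) `^ t.
Proof.
move=> [Jpos gpos gconv] gdecr pab yab t01.
have p0 := Jpos p pab; have y0 := Jpos y yab.
have gp0 := gpos p pab; have gy0 := gpos y yab.
have := pab; have := yab; have /andP[t0 t1] := t01.
rewrite !in_itv /= => /andP[ay yb] /andP[ap pb].
have a0 : 0 < a by apply: Jpos; rewrite /= in_itv /= lexx (le_trans ay).
have amgm := @powR_weighted_AMGM R y p t y0 p0 t01.
have cb : t * y + (1 - t) * p <= b by nra.
(* To apply [gdecr] the geometric mean must lie in [[a, b]]: [a] is the geometric mean of itself
   with itself, and the bound by [b] follows from [amgm] and [cb]. *)
have gm : a <= y `^ t * p `^ (1 - t).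
  have {1}-> : a = a `^ t * a `^ (1 - t).
    rewrite -powRD; last by rewrite (gt_eqF a0) implybT.
    by rewrite addrC subrK powRr1// ltW.
  by apply: ler_pM; rewrite ?powR_ge0 ?ge0_ler_powR ?nnegrE ?subr_ge0
    ?(ltW a0) ?(ltW y0) ?(ltW p0).
apply: (@le_trans _ _ (g (y `^ t * p `^ (1 - t)))).
  by apply: gdecr => //; rewrite in_itv /= ?gm ?(le_trans amgm)// (le_trans gm).
apply: le_trans (gconv _ _ _ yab pab t01) _.
rewrite powRM ?invr_ge0 ?(ltW gy0) ?(ltW gp0)//.
rewrite -[(g p)^-1]powR_inv1 ?(ltW gp0)// -powRrM mulN1r.
rewrite mulrCA powRD; last by rewrite (gt_eqF gp0) implybT.
by rewrite powRr1 ?(ltW gp0).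
Qed.

(** * Assembly of the inequality *)

Lemma trapezoid_bound (R : realType) (f f' : R -> R) (a b q x : R) :
  a < b -> 1 <= q -> {within `[a, b], continuous f} ->
  (forall t : R, t \in `]a, b[ -> is_derive t 1 f (f' t)) ->
  geometrically_convex `[a, b] (fun u => `|f' u| `^ q) ->
  {in `[a, b] &, nonincreasing_fun (fun u => `|f' u| `^ q)} ->
  x \in `[a, b] ->
  `| ((b - x) * f b + (x - a) * f a) / (b - a)
     - (b - a)^-1 * \int[lebesgue_measure]_(u in `[a, b]) f u |
  <= (1 / 2) `^ (1 - 1 / q) *
     ( (x - a) ^+ 2 / (b - a) * `|f' a| *
         log_coef (`|f' x| `^ q / `|f' a| `^ q) `^ (1 / q)
     + (b - x) ^+ 2 / (b - a) * `|f' b| *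
         log_coef (`|f' x| `^ q / `|f' b| `^ q) `^ (1 / q)).
Proof.
move=> hab hq fc fd hconv hdecr hx.
have q0 : 0 < q by exact: lt_le_trans hq.
have qn0 : q != 0 by rewrite gt_eqF.
have aab : a \in `[a, b] by rewrite in_itv /= lexx ltW.
have bab : b \in `[a, b] by rewrite in_itv /= lexx ltW.
have [G [Gc Gd ->]] := continuous_antiderivative _ _ _ _ hab fc.
(* The positivity clause of [hconv] excludes [f' t = 0], because 0 raised to the nonzero power [q]
   is 0. *)
have f'gt0 t : t \in `[a, b] -> 0 < `|f' t|.
  move=> tab; rewrite normr_gt0; apply/eqP => f't0.
  have [_ /(_ t tab) + _] := hconv.
  by rewrite /= f't0 normr0 powR0// ltxx.
have bound p : p \in `[a, b] -> `|G x - G p - (x - p) * f p| <=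
    (x - p) ^+ 2 * `|f' p| * ((1 / 2) `^ (1 - 1 / q) *
      log_coef (`|f' x| `^ q / `|f' p| `^ q) `^ (1 / q)).
  move=> pab.
  have xp0 : 0 < `|f' x| `^ q / `|f' p| `^ q.
    by rewrite divr_gt0// powR_gt0// f'gt0.
  apply: (segment_taylor1 _ _ _ _ _ _ _ _ _ _ fc Gc fd Gd) => // t.
  rewrite in_itv /= => /andP[t0 t1].
  have t01 : 0 <= t <= 1 by rewrite !ltW.
  have := geometrically_convex_decreasing_le _ _ _ _ p x t hconv hdecr pab hx t01.
  rewrite /= => H.
  have root_q z : 0 <= z -> (z `^ q) `^ q^-1 = z.
    by move=> z0; rewrite -powRrM divff// powRr1.
  have iq0 : 0 <= q^-1 by rewrite invr_ge0 ltW.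
  have := ge0_ler_powR iq0 _ _ H.
  rewrite !nnegrE powR_ge0 mulr_ge0 ?powR_ge0// => /(_ isT isT).
  by rewrite powRM ?powR_ge0// !root_q ?normr_ge0.
have Ba := bound a aab; have Bb := bound b bab.
set c := (1 / 2) `^ _ in Ba Bb *.
set u := log_coef _ `^ _ in Ba *; set v := log_coef _ `^ _ in Bb *.
have ba0 : 0 < b - a by rewrite subr_gt0.
have -> : ((b - x) * f b + (x - a) * f a) / (b - a) - (b - a)^-1 * (G b - G a) =
    ((G x - G b - (x - b) * f b) - (G x - G a - (x - a) * f a)) / (b - a).
  by field; rewrite gt_eqF.
have -> : c * ((x - a) ^+ 2 / (b - a) * `|f' a| * u +
               (b - x) ^+ 2 / (b - a) * `|f' b| * v) =
   ((x - b) ^+ 2 * `|f' b| * (c * v) +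
    (x - a) ^+ 2 * `|f' a| * (c * u)) / (b - a).
  by field; rewrite gt_eqF.
rewrite normrM [`|(b - a)^-1|]gtr0_norm ?invr_gt0// ler_pM2r ?invr_gt0//.
exact: le_trans (ler_normB _ _) (lerD Bb Ba).
Qed.

Theorem theorem5 (R : realType) (I : set R) (f : R -> R) (a b q x : R)
  (hI : is_interval I)
  (hfpos : forall u, I u -> 0 < f u)
  (hfI : forall u, I° u -> derivable f u 1)
  (ha : I a) (hb : I b) (hab : a < b)
  (hfa : derivable_within I f a)
  (hfb : derivable_within I f b)
  (hint : lebesgue_measure.-integrable `[a, b]
            (fun u => (derive_within I f u)%:E))
  (hq : 1 <= q)
  (hconv : geometrically_convex `[a, b]
             (fun u => `|derive_within I f u| `^ q))
  (hdecr : {in `[a, b] &,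
             nonincreasing_fun (fun u => `|derive_within I f u| `^ q)})
  (hx : x \in `[a, b]) :
  let f' := derive_within I f in
  let k := `|f' x| `^ q / `|f' a| `^ q in
  let l := `|f' x| `^ q / `|f' b| `^ q in
  `| ((b - x) * f b + (x - a) * f a) / (b - a)
     - (b - a)^-1 * \int[lebesgue_measure]_(u in `[a, b]) f u |
  <= (1 / 2) `^ (1 - 1 / q) *
     ( (x - a) ^+ 2 / (b - a) * `|f' a| * log_coef k `^ (1 / q)
     + (b - x) ^+ 2 / (b - a) * `|f' b| * log_coef l `^ (1 / q)).
Proof.
have intI t : t \in `]a, b[ -> I° t.
  move=> tab; apply: (@interiorS _ `[a, b]); last by rewrite interior_itv.
  by move=> s /= /[!in_itv] /=; exact: hI.
have fd (t : R) : t \in `]a, b[ -> is_derive t 1 f (derive_within I f t).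
  move=> /intI It.
  rewrite (derive_within_interior f It) derive1E.
  exact: derivableP (hfI t It).
have fc : {within `[a, b], continuous f}.
  (* The points [a] and [b] may be endpoints of [I], so there one-sided derivability is supplied by
     [hfa] and [hfb]. *)
  have It t : t \in `[a, b] -> derivable_within I f t.
    rewrite in_itv /= => /andP[]; rewrite le_eqVlt => /predU1P[<-//|at_].
    rewrite le_eqVlt => /predU1P[->//|tb].
    have tab : t \in `]a, b[ by rewrite in_itv /= at_.
    by apply/derivable_within_interior; [exact: intI|apply: hfI; exact: intI].
  apply/subspace_continuousP => t tab.
  apply: cvg_trans (derivable_within_cvg _ _ _ _ (It t tab)).
  apply: cvg_app; apply: within_subset.
  by move=> s /= /[!in_itv] /=; exact: hI.
exact: (trapezoid_bound _ _ _ _ _ _ _ hab hq fc fd hconv hdecr hx).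
Qed.
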